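(* Let $(b_n(\lambda))_{n\ge 0}$ be the sequence of polynomials in $\lambda$ defined by $b_0(\lambda)=1$ and, for $n\ge 1$, $$b_{n}(\lambda) = -\lambda b_{n-1}(\lambda)-\frac{1}{4}\sum_{i=2}^{n}(-2)^{i}b_{n-i}(\lambda).$$ Then for all $n\ge 0$, $$b_{n}(\lambda) = \sum_{t=0}^{n}\sum_{k=0}^{n}\sum_{\ell=0}^{k}\binom{k}{t}\binom{t}{\ell}(-1)^{k}2^{2k-n+t-2\ell}\left[4\binom{k-t}{2k-n-\ell+1}+\binom{k-t}{2k-n-\ell}\right] \lambda^{t}.$$
   Context: Empty sums are $0$. Binomial coefficients $\binom{a}{b}$ with $a\ge 0$ are $0$ when $b<0$ or $b>a$ (terms with $k<t$ vanish because of the factor $\binom{k}{t}$). Powers of $2$ with negative exponents are rational numbers. *)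

(* Defs.v *)
From HB Require Import structures.
From mathcomp Require Import all_boot all_order all_algebra.

Set Implicit Arguments.
Unset Strict Implicit.
Unset Printing Implicit Defensive.

Import Order.TTheory GRing.Theory Num.Theory.
Local Open Scope ring_scope.

(* Binomial coefficient with a possibly negative lower index, equal to 0 when
   b < 0; it is also 0 when b > a, by the convention of 'C(a, b). *)
Definition binomz (a : nat) (b : int) : nat :=
  match b with
  | Posz m => 'C(a, m)
  | Negz _ => 0%N
  end.

(* Main.v *)
(* Write L for lambda. Eliminating the convolution sum gives the three-term
   recurrence b_{m+2} = -(2 + L) b_{m+1} - (1 + 2 L) b_m, so the generating
   series of b is
     (1 + 2x) / (1 + x (2 + L + (1 + 2 L) x))
       = (1 + 2x) sum_k (-x)^k ((2 + x) + L (1 + 2x))^k.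
   Expanding the k-th power by the binomial theorem, and then (1 + 2x)^t and
   (2 + x)^(k - t), the coefficient of x^n is the claimed sum; the factor
   1 + 2x accounts for the two binomials in the bracket.  Since the k-th term
   is divisible by x^k, only k <= n matters and polynomials in x over Q[L]
   replace power series. *)
Require Import Defs.
From HB Require Import structures.
From mathcomp Require Import all_boot all_order all_algebra.
From mathcomp Require Import zify ring.

Set Implicit Arguments.
Unset Strict Implicit.
Unset Printing Implicit Defensive.

Import Order.TTheory GRing.Theory Num.Theory.
Local Open Scope ring_scope.

(** The generating series is [p / (1 - y)] with [y = - 'X * (u + v 'X)]; since ['X] divides [y], the
    geometric series may be cut after [y ^+ n]. *)
Lemma linear_recurrence2_coef (R : comNzRingType) (u v : R) (c : nat -> R) :
    (forall n, c n.+2 = - u * c n.+1 - v * c n) ->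
  forall n, c n = (((c 0%N)%:P + (c 1%N + u * c 0%N)%:P * 'X)
                   * \sum_(k < n.+1) (- ('X * (u%:P + v%:P * 'X))) ^+ k)`_n.
Proof.
move=> cS n; set p := _ + _ * 'X; set q := _ + _ * 'X; set y := - _.
pose C := \poly_(i < n.+1) c i.
(* Cutting the series at degree [n] only disturbs coefficients beyond [n]. *)
have low i : (i <= n)%N -> (C * (1 - y))`_i = p`_i.
  have -> : C * (1 - y) = C + 'X * (u%:P * C + v%:P * (C * 'X)).
    by rewrite /y /q; ring.
  rewrite /p !coefD coefXM coefC coefMX coefC coef_poly ltnS => lein.
  rewrite lein; case: i lein => [|[|i]] lein /=.
  - by rewrite !addr0.
  - rewrite coefD !coefCM coefMX coef_poly ltnS (ltnW lein) /= mulr0.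
    by rewrite addr0 add0r.
  rewrite coefD !coefCM coefMX !coef_poly ltnS (ltnW lein) /= ltnS.
  by rewrite (ltnW (ltnW lein)) cS; ring.
(* [y ^+ n.+1] is a multiple of ['X^n.+1], invisible in degree [n]. *)
transitivity (C * (1 - y ^+ n.+1))`_n.
  rewrite mulrBr mulr1 coefB /y -mulrN exprMn mulrCA coefXnM ltnSn subr0.
  by rewrite coef_poly ltnSn.
have -> : 1 - y ^+ n.+1 = (1 - y) * \sum_(k < n.+1) y ^+ k.
  by rewrite -opprB subrX1 -mulNr opprB.
rewrite mulrA !coefM; apply: eq_bigr => i _.
by rewrite low // -ltnS.
Qed.

Lemma coef_X2Dn (s j : nat) :
  ((2%:P + 'X : {poly rat}) ^+ s)`_j = 2 ^+ (s - j) *+ 'C(s, j).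
Proof.
rewrite exprDn coef_sum.
under eq_bigr do rewrite coefMn -polyC_exp mul_polyC coefZ coefXn.
case: (ltnP j s.+1) => [js|sj].
  rewrite (bigD1 (Ordinal js)) //= eqxx mulr1 big1 ?addr0 // => i.
  by rewrite -val_eqE /= eq_sym => /negbTE ->; rewrite mulr0 mul0rn.
rewrite bin_small // mulr0n big1 // => i _.
by rewrite eqn_leq [(j <= i)%N]leqNgt (leq_trans (ltn_ord i) sj) mulr0 mul0rn.
Qed.

(** Choosing [(2 'X)^(t - l)] from the first power leaves degree [n - a - t + l] for the second; its
    binomial is reflected by [bin_sub]. The free bound [m] allows a range of [l] independent of
    [t]. *)
Lemma coef_XnM_binomials (a t s m n : nat) : (t <= m)%N ->
  ('X^a * ((1 + 2%:P * 'X) ^+ t * (2%:P + 'X) ^+ s) : {poly rat})`_n =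
  \sum_(0 <= l < m.+1) 'C(t, l)%:R
    * (2 : rat) ^ ((a + s + t)%N%:Z + t%:Z - n%:Z - 2 * l%:Z)
    * (binomz s ((a + s + t)%N%:Z - n%:Z - l%:Z))%:R.
Proof.
move=> tm; rewrite [RHS](big_cat_nat (n := t.+1)) //=.
rewrite [X in _ = _ + X]big_nat_cond [X in _ = _ + X]big1 => [|l]; last first.
  by case/andP=> /andP[tl _] _; rewrite bin_small // !mul0r.
rewrite addr0 big_mkord [1 + _]addrC exprDn mulr_suml mulr_sumr coef_sum.
apply: eq_bigr => l _; have lt : (l <= t)%N by rewrite -ltnS.
rewrite expr1n mulr1 exprMn -polyC_exp -mulrnAl -polyCMn -!mulrA mulrCA coefCM.
rewrite ['X^a * _]mulrA -exprD coefXnM [LHS]mulrnAl -[LHS]mulr_natl.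
congr (_ * _).
(* A negative remaining degree corresponds to a lower index above [s], one exceeding [s] to a
   negative lower index. *)
case: ltnP => [na|an].
  case def_z: (_ - l%:Z) => [j|j] /=; last by rewrite !mulr0.
  by rewrite bin_small ?mulr0 //; lia.
rewrite coef_X2Dn -[2 ^+ (s - _) *+ _]mulr_natr.
case: (leqP (n - (a + (t - l))) s) => [js|sj]; last first.
  rewrite bin_small // !mulr0.
  case def_z: (_ - l%:Z) => [j|j] /=; last by rewrite !mulr0.
  lia.
rewrite mulrA -exprD -bin_sub //.
have -> : (a + s + t)%N%:Z - n%:Z - l%:Z = (s - (n - (a + (t - l))))%N :> int.
  lia.
by congr (_ * _); rewrite exprnP; congr (_ ^ _); lia.
Qed.

(* In the closed form, k - t is truncated: terms with k < t vanish through
   the factor 'C(k, t). *)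
Theorem theorem17 (b : nat -> {poly rat})
  (b0 : b 0%N = 1)
  (bS : forall n : nat, (1 <= n)%N ->
     b n = - 'X * b (n - 1)%N
           - (1 / 4 : rat) *: \sum_(2 <= i < n.+1) (- 2 : rat) ^+ i *: b (n - i)%N)
  (n : nat) :
  b n = \sum_(0 <= t < n.+1) \sum_(0 <= k < n.+1) \sum_(0 <= l < k.+1)
          (('C(k, t))%:R * ('C(t, l))%:R * (- 1) ^+ k
           * (2 : rat) ^ (2 * k%:Z - n%:Z + t%:Z - 2 * l%:Z)
           * (4 * (binomz (k - t)%N (2 * k%:Z - n%:Z - l%:Z + 1))%:R
              + (binomz (k - t)%N (2 * k%:Z - n%:Z - l%:Z))%:R)) *: 'X^t.
Proof.
have b1 : b 1%N = - 'X.
  by rewrite bS // subnn b0 mulr1 big_geq // scaler0 subr0.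
have brec m : b m.+2 = - (2 + 'X) * b m.+1 - (1 + 2 * 'X) * b m.
  (* The geometric weights give [S] a one-step recurrence, and the hypothesis at [m.+1] expresses
     [S m.+1] through [b]. *)
  pose S j := \sum_(2 <= i < j.+1) (- 2 : rat) ^+ i *: b (j - i)%N.
  have S_rec : S m.+2 = 4 *: b m - 2 *: S m.+1.
    rewrite /S big_nat_recl // subSS subSS subn0; congr (_ *: _ + _).
    rewrite scaler_sumr -sumrN; apply: eq_bigr => i _.
    by rewrite subSS exprS scalerA -scaleNr mulNr.
  have E1 : S m.+1 = - 4 *: (b m.+1 + 'X * b m).
    rewrite (bS m.+1) // subSS subn0 -/(S _) mulNr addrAC addNr add0r.
    by rewrite scalerN scaleNr opprK scalerA divrr ?scale1r.
  rewrite (bS m.+2) // subSS subn0 -/(S _) S_rec E1.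
  have -> : (1 / 4 : rat) *: (4 *: b m - 2 *: (- 4 *: (b m.+1 + 'X * b m)))
            = b m + 2 * (b m.+1 + 'X * b m).
    rewrite scalerBr !scalerA -scaleNr -scaler_nat -scalerAl !mul1r.
    by rewrite -[X in _ = X + _]scale1r; congr (_ *: _ + _ *: _).
  by ring.
rewrite (linear_recurrence2_coef brec) b0 b1 mulr1.
have -> : - 'X + (2 + 'X) = 2 :> {poly rat} by ring.
pose P k t : {poly rat} := (1 + 2%:P * 'X) ^+ t * (2%:P + 'X) ^+ (k - t).
(* The outer variable is x, the inner one lambda. Regrouping by lambda leaves coefficients in Q[x],
   embedded by [map_poly polyC]. *)
have powE k : (k <= n)%N ->
  (- ('X * ((2 + 'X)%:P + (1 + 2 * 'X)%:P * 'X))) ^+ k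
   = \sum_(0 <= t < n.+1) ('X^t)%:P
       * map_poly polyC (((-1) ^+ k * 'C(k, t)%:R) *: ('X^k * P k t)).
  move=> kn; rewrite (big_cat_nat (n := k.+1)) //=.
  rewrite [X in _ = _ + X]big_nat_cond [X in _ = _ + X]big1 => [|t]; last first.
    case/andP=> /andP[kt _] _.
    by rewrite bin_small // mulr0 scale0r rmorph0 mulr0.
  have -> : 'X * ((2 + 'X)%:P + (1 + 2 * 'X)%:P * 'X)
     = 'X * ((2 + 'X) + 'X%:P * (1 + 2 * 'X)) :> {poly {poly rat}}.
    rewrite !rmorphD !rmorphM /= !rmorph1; ring.
  rewrite [LHS]exprNn ['X * (_ + _)]mulrC exprMn addr0 big_mkord.
  rewrite exprDn mulr_suml mulr_sumr; apply: eq_bigr => t _.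
  rewrite -mul_polyC [_^:P]rmorphM /= map_polyC /=.
  have -> : ('X^k * P k t)^:P = 'X^k * ((1 + 2 * 'X) ^+ t * (2 + 'X) ^+ (k - t)).
    by rewrite !rmorphM !rmorphXn !rmorphD !rmorphM /= map_polyX !rmorphD !rmorph1.
  have -> : ((-1) ^+ k * 'C(k, t)%:R)%:P%:P
            = (-1) ^+ k * 'C(k, t)%:R :> {poly {poly rat}}.
    by rewrite !rmorphM /= !rmorph_sign !rmorph_nat.
  rewrite -mulr_natl exprMn [('X^t)%:P]rmorphXn /=; ring.
rewrite mulr_sumr coef_sum [RHS]exchange_big /= [RHS]big_mkord.
apply: eq_bigr => k _; have kn : (k <= n)%N by rewrite -ltnS.
rewrite powE // mulr_sumr coef_sum; apply: eq_big_nat => t _.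
rewrite -scaler_suml -mul_polyC mulrCA coefCM mulrC; congr (_ * _).
have -> : 1%:P + 2%:P * 'X = map_poly polyC (1 + 2%:P * 'X : {poly rat}).
  by rewrite [RHS]rmorphD rmorphM /= map_polyX [(2%:P)^:P]map_polyC !rmorph1 /= !rmorph_nat.
rewrite -rmorphM coef_map /=; congr _%:P.
case: (leqP t k) => [tk|kt]; last first.
  rewrite bin_small // mulr0 scale0r mulr0 coef0 big1 // => l _.
  by rewrite !mul0r.
(* The terms 1 and 2x of the numerator use [a = k] and [a = k.+1]; the latter raises the lower index
   by 1 and doubles the power of 2, whence the factor 4. *)
rewrite -scalerAr mulrDl mul1r -!mulrA ['X * _]mulrA -exprS coefZ coefD coefCM.
rewrite !(coef_XnM_binomials _ _ _ tk).
rewrite mulr_sumr -big_split mulr_sumr /=; apply: eq_bigr => l _.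
have -> : (k.+1 + (k - t) + t)%N%:Z - n%:Z - l%:Z = 2 * k%:Z - n%:Z - l%:Z + 1 by lia.
have -> : (k + (k - t) + t)%N%:Z - n%:Z - l%:Z = 2 * k%:Z - n%:Z - l%:Z by lia.
have -> : (k.+1 + (k - t) + t)%N%:Z + t%:Z - n%:Z - 2 * l%:Z
   = 1 + (2 * k%:Z - n%:Z + t%:Z - 2 * l%:Z) by lia.
have -> : (k + (k - t) + t)%N%:Z + t%:Z - n%:Z - 2 * l%:Z
   = 2 * k%:Z - n%:Z + t%:Z - 2 * l%:Z by lia.
set e := _ - 2 * l%:Z; rewrite (expfzDr 1 e) // expr1z; ring.
Qed.
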